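(* The map $\pi:R_I(2,2)\to\mathbb{E}$ has no analytic right inverse; that is, there is no analytic map $h:\mathbb{E}\to R_I(2,2)$ such that $\pi\circ h=\mathrm{id}_{\mathbb{E}}$.
   Context: The tetrablock is $\mathbb{E}=\{x\in\mathbb{C}^3: 1-x_1z-x_2w+x_3zw\ne0 \text{ whenever } |z|\le1,\ |w|\le1\}$. $R_I(2,2)=\{A\in\mathbb{C}^{2\times2}:\|A\|<1\}$ is the open unit ball of the $2\times2$ complex matrices in the operator norm. For $A=[a_{ij}]\in\mathbb{C}^{2\times2}$, $\pi(A)=(a_{11},a_{22},\det A)$; $\pi$ maps $R_I(2,2)$ onto $\mathbb{E}$. *)

(* Defs.v *)
From HB Require Import structures.
From mathcomp Require Import all_boot all_order all_algebra.
From mathcomp Require Import complex.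
From mathcomp Require Import all_classical all_reals all_analysis.

Set Implicit Arguments.
Unset Strict Implicit.
Unset Printing Implicit Defensive.

Import Order.TTheory GRing.Theory Num.Theory.
Import numFieldNormedType.Exports.

Local Open Scope classical_set_scope.
Local Open Scope ring_scope.
Local Open Scope complex_scope.

Definition tetrablock (R : realType) : set 'rV[R[i]]_3 :=
  [set x | forall z w : R[i], `|z| <= 1 -> `|w| <= 1 ->
     1 - x 0 0 * z - x 0 1 * w + x 0 2 * z * w != 0].

Definition l2norm (R : realType) (n : nat) (v : 'cV[R[i]]_n) : R :=
  Num.sqrt (\sum_(k < n) Normc.normc (v k 0) ^+ 2).

(* The norm `|A| that MathComp-Analysis puts on matrices is the maximum of the
   moduli of the entries, so the operator norm for the Euclidean norm on
   C^n has to be introduced separately. The set below is nonempty and bounded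
   above, so sup is a genuine supremum. *)
Definition opnorm (R : realType) (m n : nat) (A : 'M[R[i]]_(m, n)) : R :=
  sup [set l2norm (A *m v) | v in [set v : 'cV[R[i]]_n | l2norm v <= 1]].

Definition RI22 (R : realType) : set 'M[R[i]]_2 := [set A | opnorm A < 1].

Definition pi_map (R : realType) (A : 'M[R[i]]_2) : 'rV[R[i]]_3 :=
  \row_(k < 3) [:: A 0 0; A 1 1; \det A]`_k.

(* Analyticity on an open subset D of a complex normed space: Frechet
   differentiability over the scalar field R[i] (so with a C-linear
   differential) at every point of D. The differential at a point of the open
   set D only depends on f near that point, hence on the restriction of f to D:
   the values of f outside D are irrelevant. *)
Definition analytic_on (R : realType) (V W : normedModType R[i])
    (D : set V) (f : V -> W) : Prop :=
  forall x, D x -> differentiable f x.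

(* Main.v *)
(* Let [h] be an analytic right inverse and let [b], [c] be the off-diagonal
   entries of [h], so that [b c = x1 x2 - x3] on the tetrablock. At [(z, 0, 0)]
   the first column of [h] is [(z, c)], whence [|z|^2 + |c|^2 < 1]: the function
   [z |-> c (z, 0, 0)] tends to 0 at the boundary of the unit disc and therefore
   vanishes at 0. Likewise, the second column at [(0, w, 0)] gives [b 0 = 0].
   Hence [b c] vanishes to second order at 0, which is absurd since
   [b c = - x3] on the third axis.

   The vanishing of [c] at 0 amounts to the mean value property. Pulling back
   by [exp (s + i t)], it says that the integral over [0 <= t <= 2 pi] of the
   real part does not depend on [s < 0], which is the closedness of the real
   1-form [Im f ds + Re f dt]. Since only pointwise differentiability is
   assumed, this is Goursat's bisection argument. *)

Require Import Defs.
From HB Require Import structures.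
From mathcomp Require Import all_boot all_order all_algebra.
From mathcomp Require Import complex.
From mathcomp Require Import all_classical all_reals all_analysis.
From mathcomp Require Import ring lra.

Set Implicit Arguments.
Unset Strict Implicit.
Unset Printing Implicit Defensive.

Import Order.TTheory GRing.Theory Num.Theory.
Import numFieldNormedType.Exports.

Local Open Scope classical_set_scope.
Local Open Scope ring_scope.
Local Open Scope complex_scope.

(** * Goursat's theorem for real differential forms *)

Section Goursat.
Variable R : realType.
Implicit Types (P Q : R -> R -> R) (f g : R -> R).

(** * Integrals over segments *)

Definition segint f (a b : R) : R :=
  \int[@lebesgue_measure R]_(x in `[a, b]) f x.

Let segment_integrable f (a b : R) : (forall x, a <= x <= b -> {for x, continuous f}) ->
  (@lebesgue_measure R).-integrable `[a, b] (EFin \o f).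
Proof.
move=> cf; apply: continuous_compact_integrable; first exact: segment_compact.
apply: continuous_in_subspaceT => x; rewrite inE /= in_itv /=; exact: cf.
Qed.

Lemma segint_add f (a b c : R) : a <= b -> b <= c ->
  (forall x, a <= x <= c -> {for x, continuous f}) ->
  segint f a c = segint f a b + segint f b c.
Proof.
move=> ab bc cf; have fi := segment_integrable cf.
apply/eqP; rewrite addrC -subr_eq /segint.
rewrite Rintegral_itvB // Rintegral_itv_obnd_cbnd //.
apply: integrableS fi => //; apply: subset_itvr; rewrite bnd_simp //.
Qed.

(** Integrate the pointwise bound. This serves twice: for opposite sides of a small rectangle, and
    for two concentric circles in the mean value argument. *)
Lemma segint_sub_bound f g (a b c e : R) : a <= b ->
  (forall x, a <= x <= b -> {for x, continuous f}) ->
  (forall x, a <= x <= b -> {for x, continuous g}) ->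
  (forall x, a <= x <= b -> `|f x - g x - c| <= e) ->
  `|segint f a b - segint g a b - c * (b - a)| <= e * (b - a).
Proof.
move=> ab cf cg le_e.
have [fi gi] := (segment_integrable cf, segment_integrable cg).
have cst k : segint (fun=> k) a b = k * (b - a).
  rewrite /segint Rintegral_cst //= lebesgue_measure_itv /= lte_fin.
  move: ab; rewrite le_eqVlt => /predU1P[->|->]; last by rewrite -EFinD.
  by rewrite ltxx subrr.
have ccst k : (@lebesgue_measure R).-integrable `[a, b] (EFin \o (fun=> k : R)).
  by apply: segment_integrable => x _; exact: cst_continuous.
have cfg x : a <= x <= b -> {for x, continuous (fun y => f y - g y)}.
  by move=> xab; apply: continuousB; [exact: cf|exact: cg].
have cfgc x : a <= x <= b -> {for x, continuous (fun y => f y - g y - c)}.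
  by move=> xab; apply: continuousB; [exact: cfg|exact: cst_continuous].
have [fgi fgci] := (segment_integrable cfg, segment_integrable cfgc).
rewrite -[c * _]cst -[e * _]cst /segint -RintegralB // -RintegralB //.
apply: le_trans (le_normr_Rintegral _ _) _ => //.
apply: le_Rintegral => //; first apply: segment_integrable => x xab.
  by apply: continuous_comp; [exact: cfgc|exact: norm_continuous].
Qed.

(* The 1-form [P ds + Q dt] is differentiable at [(s, t)], with equal mixed
   partial derivatives [dP/dt = dQ/ds = a]. *)
Definition closed_at P Q (s t : R) := exists a p q : R,
  forall e : R, 0 < e -> exists2 d : R, 0 < d &
    forall x y : R, `|x| < d -> `|y| < d ->
      `|P (s + x) (t + y) - P s t - (p * x + a * y)| <= e * (`|x| + `|y|) /\
      `|Q (s + x) (t + y) - Q s t - (a * x + q * y)| <= e * (`|x| + `|y|).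

(** The circulation of [P ds + Q dt] counterclockwise around the boundary of [[s1, s2] x
    [t1, t2]]. *)
Definition loopint P Q (s1 s2 t1 t2 : R) : R :=
  segint (Q s2) t1 t2 - segint (Q s1) t1 t2
  - (segint (P^~ t2) s1 s2 - segint (P^~ t1) s1 s2).

Let lip_continuous f (x a : R) :
  (forall e : R, 0 < e -> exists2 d : R, 0 < d &
     forall y, `|y| < d -> `|f (x + y) - f x - a * y| <= e * `|y|) ->
  {for x, continuous f}.
Proof.
move=> H; apply/cvgrPdist_lt => e e0; have [d d0 Hd] := H _ ltr01.
have k0 : 0 < `|a| + 2 by rewrite ltr_wpDl.
near=> y.
have yx : `|y - x| < Num.min d (e / (`|a| + 2)).
  near: y; exists (Num.min d (e / (`|a| + 2))) => /=; first by rewrite lt_min d0 divr_gt0.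
  by move=> z /=; rewrite distrC.
move: yx; rewrite lt_min => /andP[yd ye].
have := Hd _ yd; rewrite subrKC mul1r => {}Hd.
rewrite distrC; rewrite ltr_pdivlMr // in ye.
have -> : f y - f x = (f y - f x - a * (y - x)) + a * (y - x) by ring.
apply: le_lt_trans (ler_normD _ _) _; rewrite normrM.
move: Hd ye; have := normr_ge0 (y - x); have := normr_ge0 a.
case: (eqVneq `|y - x| 0) => [->|yn0]; first by rewrite !mulr0; lra.
rewrite -normr_gt0 normr_id in yn0; nra.
Unshelve. all: by end_near. Qed.

Lemma closed_at_continuous1 P Q s t : closed_at P Q s t -> {for s, continuous (P^~ t)}.
Proof.
case=> a [p [q H]]; apply: (@lip_continuous _ s p) => e e0.
have [d d0 Hd] := H _ e0; exists d => // y yd.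
have [] := Hd y 0; rewrite ?normr0 // => + _.
by rewrite !addr0 mulr0 addr0.
Qed.

Lemma closed_at_continuous2 P Q s t : closed_at P Q s t -> {for t, continuous (Q s)}.
Proof.
case=> a [p [q H]]; apply: (@lip_continuous _ t q) => e e0.
have [d d0 Hd] := H _ e0; exists d => // y yd.
have [] := Hd 0 y; rewrite ?normr0 // => _.
by rewrite addr0 mulr0 !add0r.
Qed.

(** Each inner side is run through once in either direction and cancels; only the four outer sides
    have to be split. *)
Lemma loopint_quarter P Q (s1 s s2 t1 t t2 : R) :
  s1 <= s -> s <= s2 -> t1 <= t -> t <= t2 ->
  (forall x y, s1 <= x <= s2 -> t1 <= y <= t2 -> closed_at P Q x y) ->
  loopint P Q s1 s2 t1 t2 =
    loopint P Q s1 s t1 t + loopint P Q s1 s t t2 +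
    (loopint P Q s s2 t1 t + loopint P Q s s2 t t2).
Proof.
move=> s1s ss2 t1t tt2 H.
have s1s2 := le_trans s1s ss2; have t1t2 := le_trans t1t tt2.
have addQ x : s1 <= x <= s2 -> segint (Q x) t1 t2 = segint (Q x) t1 t + segint (Q x) t t2.
  by move=> xs; apply: segint_add => // y yt; apply: closed_at_continuous2 (H _ _ xs yt).
have addP y : t1 <= y <= t2 ->
    segint (P^~ y) s1 s2 = segint (P^~ y) s1 s + segint (P^~ y) s s2.
  move=> yt; apply: segint_add => // x xs; exact: closed_at_continuous1 (H _ _ xs yt).
rewrite /loopint (addQ s1) ?lexx // (addQ s2) ?lexx ?s1s2 ?t1t2 //.
rewrite (addP t1) ?lexx ?t1t2 // (addP t2) ?lexx ?t1t2 //; ring.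
Qed.

(** Since the mixed partials agree, the affine parts of [P] and [Q] contribute the same
    [a * (s2 - s1) * (t2 - t1)] to the two pairs of opposite sides and cancel. Only the remainders
    are left, integrated over sides of total length comparable to the diameter. *)
Lemma loopint_small P Q (s t e : R) : closed_at P Q s t -> 0 < e ->
  exists2 d : R, 0 < d & forall s1 s2 t1 t2 : R,
    s1 <= s <= s2 -> t1 <= t <= t2 -> s2 - s1 < d -> t2 - t1 < d ->
    (forall x y, s1 <= x <= s2 -> t1 <= y <= t2 -> closed_at P Q x y) ->
    `|loopint P Q s1 s2 t1 t2| <= e * (s2 - s1 + (t2 - t1)) ^+ 2.
Proof.
(* Half of [e], because subtracting the values on opposite sides adds up two remainders. *)
move=> [a [p [q H]]] e0; have e20 : 0 < e / 2 by rewrite divr_gt0.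
have [d d0 Hd] := H _ e20; exists d => // s1 s2 t1 t2 ss tt sd td HC.
have inc1 x : s1 <= x <= s2 -> `|x - s| <= s2 - s1 by move=> ?; rewrite ler_norml; lra.
have inc2 y : t1 <= y <= t2 -> `|y - t| <= t2 - t1 by move=> ?; rewrite ler_norml; lra.
have HP x y : s1 <= x <= s2 -> t1 <= y <= t2 ->
    `|P x y - P s t - (p * (x - s) + a * (y - t))| <= e / 2 * (s2 - s1 + (t2 - t1)) /\
    `|Q x y - Q s t - (a * (x - s) + q * (y - t))| <= e / 2 * (s2 - s1 + (t2 - t1)).
  move=> xs yt; have := Hd (x - s) (y - t).
  rewrite !subrKC => -[].
  1,2: by rewrite ?(le_lt_trans (inc1 _ xs)) ?(le_lt_trans (inc2 _ yt)).
  move=> h1 h2.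
  by split; [apply: le_trans h1 _|apply: le_trans h2 _]; rewrite ler_pM2l // lerD ?inc1 ?inc2.
have s12 : s1 <= s2 by lra.
have t12 : t1 <= t2 by lra.
have s1i : s1 <= s1 <= s2 by rewrite lexx.
have s2i : s1 <= s2 <= s2 by rewrite lexx andbT.
have t1i : t1 <= t1 <= t2 by rewrite lexx.
have t2i : t1 <= t2 <= t2 by rewrite lexx andbT.
have bQ : `|segint (Q s2) t1 t2 - segint (Q s1) t1 t2 - a * (s2 - s1) * (t2 - t1)|
    <= e * (s2 - s1 + (t2 - t1)) * (t2 - t1).
  apply: segint_sub_bound => // y yt; do ?[exact: closed_at_continuous2 (HC _ _ _ yt)].
  have [_] := HP _ _ s1i yt; have [_] := HP _ _ s2i yt.
  by rewrite !ler_norml; lra.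
have bP : `|segint (P^~ t2) s1 s2 - segint (P^~ t1) s1 s2 - a * (t2 - t1) * (s2 - s1)|
    <= e * (s2 - s1 + (t2 - t1)) * (s2 - s1).
  apply: segint_sub_bound => // x xs; do ?[exact: closed_at_continuous1 (HC _ _ xs _)].
  have [+ _] := HP _ _ xs t1i; have [+ _] := HP _ _ xs t2i.
  by rewrite !ler_norml; lra.
by move: bP bQ; rewrite /loopint !ler_norml; nra.
Qed.

(** If all four quarters had circulation below [c] in absolute value, their sum would stay below
    [4 * c]. *)
Lemma bisection_step P Q (s t l k c : R) : 0 <= l -> 0 <= k ->
  (forall x y, s <= x <= s + 2 * l -> t <= y <= t + 2 * k -> closed_at P Q x y) ->
  4 * c <= `|loopint P Q s (s + 2 * l) t (t + 2 * k)| ->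
  exists s' t', [/\ s <= s' <= s + l, t <= t' <= t + k &
    c <= `|loopint P Q s' (s' + l) t' (t' + k)|].
Proof.
move=> l0 k0 H big; apply: contrapT => nex.
have small s' t' : s <= s' <= s + l -> t <= t' <= t + k ->
    `|loopint P Q s' (s' + l) t' (t' + k)| < c.
  by move=> ss tt; rewrite ltNge; apply/negP => ?; apply: nex; exists s', t'.
have sl : s <= s + l by rewrite lerDl.
have tk : t <= t + k by rewrite lerDl.
have := small s t; have := small s (t + k); have := small (s + l) t.
have := small (s + l) (t + k); rewrite !lexx sl tk /= => /(_ isT isT) h1.
move=> /(_ isT isT) h2 /(_ isT isT) h3 /(_ isT isT) h4.
have sll : s + l + l = s + 2 * l by ring.
have tkk : t + k + k = t + 2 * k by ring.
rewrite sll tkk in h1; rewrite sll in h2; rewrite tkk in h3; move: big.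
rewrite (@loopint_quarter _ _ _ (s + l) _ _ (t + k)) //; try lra.
set x1 := loopint _ _ _ _ _ _ in h1 *; set x2 := loopint _ _ _ _ _ _ in h2 *.
set x3 := loopint _ _ _ _ _ _ in h3 *; set x4 := loopint _ _ _ _ _ _ in h4 *.
move: h1 h2 h3 h4; rewrite !ltr_norml ler_normr; lra.
Qed.

(** A nonzero circulation of absolute value [J] yields nested rectangles, the [n]-th carrying at
    least [J / 4 ^+ n]. They shrink to a point where [loopint_small] gives a bound of the same order
    with an arbitrarily small factor. *)
Lemma goursat P Q (s t l k : R) : 0 <= l -> 0 <= k ->
  (forall x y, s <= x <= s + l -> t <= y <= t + k -> closed_at P Q x y) ->
  loopint P Q s (s + l) t (t + k) = 0.
Proof.
move=> l0 k0 H; apply/eqP; apply/negPn/negP => J0.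
rewrite -normr_gt0 in J0; set J := `|_| in J0.
pose ln n : R := l / 2 ^+ n; pose kn n : R := k / 2 ^+ n.
have lnS n : ln n = 2 * ln n.+1.
  by rewrite /ln exprS; field; rewrite expf_eq0 pnatr_eq0 andbF.
have knS n : kn n = 2 * kn n.+1.
  by rewrite /kn exprS; field; rewrite expf_eq0 pnatr_eq0 andbF.
have ln0 n : 0 <= ln n by rewrite divr_ge0 // exprn_ge0.
have kn0 n : 0 <= kn n by rewrite divr_ge0 // exprn_ge0.
pose inside n (x : R * R) :=
  s <= x.1 /\ x.1 + ln n <= s + l /\ t <= x.2 /\ x.2 + kn n <= t + k.
pose bad n (x : R * R) :=
  J / 4 ^+ n <= `|loopint P Q x.1 (x.1 + ln n) x.2 (x.2 + kn n)|.
pose sub n (x y : R * R) := x.1 <= y.1 <= x.1 + ln n.+1 /\ x.2 <= y.2 <= x.2 + kn n.+1.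
(* The hypotheses on [x] sit under the existential, so that choice provides a total successor
   map. *)
have step n x : exists y, inside n x /\ bad n x -> sub n x y /\ bad n.+1 y.
  have [[[i1 [i2 [i3 i4]]] bx]|nx] := pselect (inside n x /\ bad n x); last by exists x.
  have := @bisection_step P Q x.1 x.2 _ _ (J / 4 ^+ n.+1) (ln0 n.+1) (kn0 n.+1).
  rewrite -lnS -knS => bis.
  have [| |a [b [h1 h2 h3]]] := bis; last by exists (a, b).
  - by move=> a b ha hb; apply: H; lra.
  - apply: le_trans bx; rewrite le_eqVlt; apply/orP; left; apply/eqP; rewrite exprS.
    by field; rewrite expf_eq0 pnatr_eq0 andbF.
have [nxt Hn] : exists nxt : nat -> R * R -> R * R, forall n x,
    inside n x /\ bad n x -> sub n x (nxt n x) /\ bad n.+1 (nxt n x).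
  have [g Hg] := choice (fun nx : nat * (R * R) => step nx.1 nx.2).
  by exists (fun n x => g (n, x)) => n x; exact: (Hg (n, x)).
pose fix c n := if n is m.+1 then nxt m (c m) else (s, t).
have Hc n : inside n (c n) /\ bad n (c n).
  elim: n => [|n IH] /=.
    by rewrite /inside /bad /ln /kn expr0 !divr1 /=; split=> //; rewrite !lexx.
  have [[h1 h2] h3] := Hn n _ IH; split=> //.
  by move: IH => [[i1 [i2 [i3 i4]]] _]; rewrite /inside; have := lnS n; have := knS n; lra.
have Hs n : sub n (c n) (c n.+1) by have [] := Hn n _ (Hc n).
have lim (u v : nat -> R) : (forall n, u n <= u n.+1) -> (forall n, v n.+1 <= v n) ->
    (forall n, u n <= v n) -> exists x, forall n, u n <= x <= v n.
  move=> iu dv uv.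
  have uvmn m n : u m <= v n.
    move/nondecreasing_seqP: iu => iu; move/nonincreasing_seqP: dv => dv.
    apply: le_trans (le_trans (uv (maxn m n)) _); first exact/iu/leq_maxl.
    exact/dv/leq_maxr.
  have hs : has_ubound (range u) by exists (v 0%N) => _ [m _ <-].
  exists (sup (range u)) => n; apply/andP; split; first by apply: ub_le_sup => //; exists n.
  by apply: ge_sup; [exists (u 0%N), 0%N|move=> _ [m _ <-]].
have [x Hx] : exists x, forall n, (c n).1 <= x <= (c n).1 + ln n.
  apply: lim => n; last by rewrite lerDl.
  - by have [/andP[]] := Hs n.
  - by have [] := Hs n; have := lnS n; lra.
have [y Hy] : exists y, forall n, (c n).2 <= y <= (c n).2 + kn n.
  apply: lim => n; last by rewrite lerDl.
  - by have [_ /andP[]] := Hs n.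
  - by have [] := Hs n; have := knS n; lra.
have Cxy : closed_at P Q x y.
  apply: H; first by have := Hx 0%N; rewrite /ln expr0 divr1.
  by have := Hy 0%N; rewrite /kn expr0 divr1.
(* Chosen so that [e * (l + k) ^+ 2 < J]; adding 1 keeps the denominator positive when
   [l = k = 0]. *)
have e0 : 0 < J / (2 * ((l + k) ^+ 2 + 1)).
  by rewrite divr_gt0 // mulr_gt0 // ltr_wpDl // sqr_ge0.
have [d d0 Hd] := loopint_small Cxy e0.
(* Take an integer [n] above [(l + k) / d] and use [n < 2 ^ n]. *)
have [n [nl nk]] : exists n, ln n < d /\ kn n < d.
  have /ltW : l + k < (Num.truncn ((l + k) / d)).+1%:R * d.
    by rewrite -ltr_pdivrMr // truncnS_gt.
  set n := _.+1 => lkn.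
  have n2 : (n%:R : R) < 2 ^+ n by rewrite -natrX ltr_nat ltn_expl.
  by exists n; rewrite /ln /kn !ltr_pdivrMr ?exprn_gt0 //; split; nra.
have [[i1 [i2 [i3 i4]]] bn] := Hc n.
have := Hd _ _ _ _ (Hx n) (Hy n).
rewrite ![_ + _ - _]addrAC !subrr !add0r => /(_ nl nk) h.
have /h {h} : forall x0 y0, (c n).1 <= x0 <= (c n).1 + ln n ->
    (c n).2 <= y0 <= (c n).2 + kn n -> closed_at P Q x0 y0.
  move=> a b /andP[a1 a2] /andP[b1 b2]; apply: H; apply/andP; split.
  - exact: le_trans a1.
  - exact: le_trans a2 _.
  - exact: le_trans b1.
  - exact: le_trans b2 _.
rewrite leNgt => /negP; apply; apply: lt_le_trans bn.
have -> : (ln n + kn n) ^+ 2 = (l + k) ^+ 2 / 4 ^+ n.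
  have -> : 4 = 2 ^+ 2 :> R by ring.
  by rewrite /ln /kn -mulrDl expr_div_n -!exprM mulnC.
rewrite mulrA ltr_pM2r ?invr_gt0 ?exprn_gt0 //.
rewrite mulrAC ltr_pdivrMr ?mulr_gt0 ?ltr_wpDl ?sqr_ge0 //.
by rewrite ltr_pM2l //; have := sqr_ge0 (l + k); lra.
Qed.
End Goursat.

(** * Holomorphic functions on the unit disc *)

Section ComplexDerivative.
Variable R : realType.
Local Notation C := R[i].
Implicit Types (f g : C -> C) (z l : C).
Import Normc.
Local Notation Re := complex.Re.
Local Notation Im := complex.Im.

(** * The modulus and complex derivatives *)

Lemma normc_ge0 z : 0 <= normc z.
Proof. by case: z => a b; exact: sqrtr_ge0. Qed.

Lemma normc_sqr z : normc z ^+ 2 = Re z ^+ 2 + Im z ^+ 2.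
Proof. by case: z => a b; rewrite sqr_sqrtr // addr_ge0 // sqr_ge0. Qed.

Lemma Re_le_normc z : `|Re z| <= normc z.
Proof.
rewrite -ler_sqr ?nnegrE ?normc_ge0 // real_normK ?num_real // normc_sqr.
by rewrite lerDl sqr_ge0.
Qed.

Lemma Im_le_normc z : `|Im z| <= normc z.
Proof.
rewrite -ler_sqr ?nnegrE ?normc_ge0 // real_normK ?num_real // normc_sqr.
by rewrite lerDr sqr_ge0.
Qed.

Lemma normc_le z : normc z <= `|Re z| + `|Im z|.
Proof.
rewrite -ler_sqr ?nnegrE ?normc_ge0 ?addr_ge0 // normc_sqr sqrrD !real_normK ?num_real //.
by have := mulr_ge0 (normr_ge0 (Re z)) (normr_ge0 (Im z)); lra.
Qed.

Lemma normc_complex_real (x : R) : normc x%:C = `|x|.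
Proof. by rewrite /= expr0n /= addr0 sqrtr_sqr. Qed.

(** The modulus [normc] takes values in [R], so all estimates are real inequalities; avoiding
    quotients allows [k = 0]. *)
Definition has_cderiv f z l := forall e : R, 0 < e -> exists2 d : R, 0 < d &
  forall k : C, normc k < d -> normc (f (z + k) - f z - l * k) <= e * normc k.

Lemma has_cderiv_lip f z l : has_cderiv f z l -> exists2 d : R, 0 < d &
  forall k : C, normc k < d -> normc (f (z + k) - f z) <= (normc l + 1) * normc k.
Proof.
move=> /(_ _ ltr01)[d d0 Hd]; exists d => // k kd.
rewrite -[f _ - _](subrK (l * k)); apply: le_trans (le_normcD _ _) _.
by rewrite mulrDl normcM addrC lerD2l Hd.
Qed.

Lemma has_cderiv_small f z l (e : R) : has_cderiv f z l -> 0 < e ->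
  exists2 d : R, 0 < d & forall k : C, normc k < d -> normc (f (z + k) - f z) < e.
Proof.
move=> /has_cderiv_lip[d d0 Hd] e0; have l0 := normc_ge0 l.
have l1 : 0 < normc l + 1 by lra.
exists (Num.min d (e / (normc l + 1))); first by rewrite lt_min d0 divr_gt0.
move=> k; rewrite lt_min => /andP[kd]; rewrite ltr_pdivlMr // mulrC; exact/le_lt_trans/Hd.
Qed.

Lemma has_cderiv_comp f g z l m :
  has_cderiv g z m -> has_cderiv f (g z) l -> has_cderiv (f \o g) z (l * m).
Proof.
move=> Hg Hf e e0; have [m0 l0] := (normc_ge0 m, normc_ge0 l).
have [m1 l1] : 0 < normc m + 1 /\ 0 < normc l + 1 by lra.
(* The increment of [g] is at most [(normc m + 1) * normc k], so the error of [f] and [l] times the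
   error of [g] each cost at most [e / 2 * normc k]. *)
have e1 : 0 < e / 2 / (normc m + 1) by rewrite !divr_gt0.
have e2 : 0 < e / 2 / (normc l + 1) by rewrite !divr_gt0.
have [d1 d10 Hd1] := Hf _ e1; have [d2 d20 Hd2] := Hg _ e2.
have [d3 d30 Hd3] := has_cderiv_lip Hg; have [d4 d40 Hd4] := has_cderiv_small Hg d10.
exists (Num.min (Num.min d2 d3) d4); first by rewrite !lt_min d20 d30 d40.
move=> k; rewrite !lt_min => /andP[/andP[k2 k3] k4] /=.
pose q := g (z + k) - g z; have gq : g (z + k) = g z + q by rewrite /q addrCA subrr addr0.
have -> : f (g (z + k)) - f (g z) - l * m * k =
  (f (g z + q) - f (g z) - l * q) + l * (q - m * k) by rewrite gq; ring.
apply: le_trans (le_normcD _ _) _; rewrite normcM.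
have h1 := Hd1 _ (Hd4 _ k4); have h2 := Hd2 _ k2; have h3 := Hd3 _ k3.
have a1 : e / 2 / (normc m + 1) * normc q <= e / 2 * normc k.
  by rewrite -mulrA ler_pM2l ?divr_gt0 // mulrC ler_pdivrMr // mulrC.
have a2 : normc l * normc (q - m * k) <= e / 2 * normc k.
  apply: le_trans (ler_wpM2l l0 h2) _.
  rewrite mulrA ler_wpM2r ?normc_ge0 // mulrCA -[leRHS]mulr1 ler_wpM2l ?divr_ge0 ?ltW //.
  by rewrite ltr_pdivrMr // mul1r ltrDl.
by apply: le_trans (lerD (le_trans h1 a1) a2) _; rewrite -mulrDl -splitr.
Qed.

(** * The complex exponential and the pulled-back 1-form *)

Definition cexp z : C := (expR (Re z))%:C * (cos (Im z) +i* sin (Im z)).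

Lemma cexpD z w : cexp (z + w) = cexp z * cexp w.
Proof.
case: z w => [a b] [c d]; rewrite /cexp /= expRD cosD sinD.
by apply/eqP; rewrite eq_complex /=; apply/andP; split; apply/eqP; ring.
Qed.

Lemma normc_cexp z : normc (cexp z) = expR (Re z).
Proof.
rewrite normcM normc_complex_real ger0_norm ?expR_ge0 //=.
by rewrite cos2Dsin2 sqrtr1 mulr1.
Qed.

Let real_deriv0 (f : R -> R) (a : R) : is_derive (0 : R) (1 : R) f a ->
  forall e : R, 0 < e -> exists2 d : R, 0 < d &
    forall x : R, `|x| < d -> `|f x - f 0 - a * x| <= e * `|x|.
Proof.
case=> df fa e e0; move: df; rewrite /derivable.
move/cvg_ex => [l Hl].
have la : l = a by rewrite -fa; apply/esym/cvg_lim.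
rewrite la in Hl; move/cvgrPdist_le: Hl => /(_ _ e0).
case=> d d0 Hd; exists d => // x xd.
have [->|x0] := eqVneq x 0; first by rewrite subrr mulr0 subrr normr0 mulr0.
have := Hd x; rewrite /ball /= sub0r normrN => /(_ xd x0).
rewrite addr0 [x *: _]mulr1 distrC => H.
have -> : f x - f 0 - a * x = (x^-1 *: (f x - f 0) - a) * x.
  by rewrite mulrBl /GRing.scale /= mulrAC mulVf // mul1r.
by rewrite normrM ler_wpM2r.
Qed.

(** By [cexpD] the claim reduces to the point 0, where it follows from the first-order expansions of
    [expR], [cos] and [sin]. *)
Lemma cexp_deriv z : has_cderiv cexp z (cexp z).
Proof.
move=> e e0; have ez := expR_gt0 (Re z); set E := expR _ in ez.
(* The tolerance [n] is at most 1 to give [expR a <= 3]. The 9 counts the error terms below: 1 + 3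
   for the real part, 3 + 1 + 1 for the imaginary part. [E] is the modulus of [cexp z]. *)
have [n [n0 n1 n2]] : exists n : R, [/\ 0 < n, n <= 1 & n <= e / (9 * E)].
  exists (Num.min 1 (e / (9 * E))); rewrite !ge_min !lexx ?orbT; split=> //.
  by rewrite lt_min ltr01 divr_gt0 // mulr_gt0.
have [d1 d10 H1] := real_deriv0 (is_derive_expR 0) n0.
have [d2 d20 H2] := real_deriv0 (is_derive_cos 0) n0.
have [d3 d30 H3] := real_deriv0 (is_derive_sin 0) n0.
exists (Num.min (Num.min 1 d1) (Num.min (Num.min d2 d3) n)).
  by rewrite !lt_min ltr01 d10 d20 d30 n0.
move=> [a b]; rewrite !lt_min => /andP[/andP[k1 k2] /andP[/andP[k3 k4] k5]].
rewrite cexpD; set k := (a +i* b) in k1 k2 k3 k4 k5 *.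
have ra : `|a| <= normc k := Re_le_normc k.
have rb : `|b| <= normc k := Im_le_normc k.
have -> : cexp z * cexp k - cexp z - cexp z * k = cexp z * (cexp k - 1 - k) by ring.
rewrite normcM normc_cexp -/E.
have := H1 a (le_lt_trans ra k2); rewrite expR0 mul1r => h1.
have := H2 b (le_lt_trans rb k3); rewrite cos0 sin0 oppr0 mul0r subr0 => h2.
have := H3 b (le_lt_trans rb k4); rewrite cos0 sin0 mul1r subr0 => h3.
have nrm0 := normc_ge0 k.
have c1 := cos_max b; have s1 := sin_max b.
have c : 9 * E * n <= e by rewrite -ler_pdivlMl ?mulr_gt0 // mulrC.
suff h : normc (cexp k - 1 - k) <= 9 * n * normc k.
  apply: le_trans (ler_wpM2l (ltW ez) h) _.
  by rewrite !mulrA [E * 9]mulrC ler_wpM2r.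
have e3 : `|expR a| <= 3.
  have na : n * `|a| <= 1 by rewrite mulr_ile1 ?(ltW n0) // ltW // (le_lt_trans ra).
  have a1 : `|a| <= 1 by rewrite ltW // (le_lt_trans ra).
  by move: (le_trans h1 na) a1; rewrite !ler_norml; lra.
apply: le_trans (normc_le _) _.
have -> : Re (cexp k - 1 - k) = (expR a - 1 - a) + expR a * (cos b - 1) by rewrite /=; ring.
have -> : Im (cexp k - 1 - k) = expR a * (sin b - b) + (expR a - 1 - a) * b + a * b
  by rewrite /=; ring.
have x1 : `|expR a * (cos b - 1)| <= 3 * (n * normc k).
  by rewrite normrM ler_pM // (le_trans h2) // ler_wpM2l // ltW.
have x2 : `|expR a * (sin b - b)| <= 3 * (n * normc k).
  by rewrite normrM ler_pM // (le_trans h3) // ler_wpM2l // ltW.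
have x3 : `|expR a - 1 - a| <= n * normc k by rewrite (le_trans h1) // ler_wpM2l // ltW.
have x4 : `|(expR a - 1 - a) * b| <= n * normc k.
  rewrite normrM -[leRHS]mulr1 ler_pM // (le_trans rb) // (le_trans (ltW k5)) //.
have x5 : `|a * b| <= n * normc k by rewrite normrM ler_pM // (le_trans ra) // ltW.
have y1 := ler_normD (expR a - 1 - a) (expR a * (cos b - 1)).
have y2 := ler_normD (expR a * (sin b - b) + (expR a - 1 - a) * b) (a * b).
have y3 := ler_normD (expR a * (sin b - b)) ((expR a - 1 - a) * b).
lra.
Qed.

(** With [g = f \o cexp] and [dz = ds + i dt], this form is the imaginary part of [g dz]. The
    Cauchy-Riemann equations make both mixed partials equal to [Re m], where [m] is the derivative
    of [g]. *)
Lemma cexp_comp_closed_at f (s t : R) l : has_cderiv f (cexp (s +i* t)) l ->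
  closed_at (fun x y => Im (f (cexp (x +i* y)))) (fun x y => Re (f (cexp (x +i* y)))) s t.
Proof.
move=> /(has_cderiv_comp (cexp_deriv _)) H; set m := l * _ in H.
exists (Re m), (Im m), (- Im m) => e e0.
have [d d0 Hd] := H _ e0; exists (d / 2); first by rewrite divr_gt0.
move=> x y xd yd; have xyd : normc (x +i* y) < d.
  apply: le_lt_trans (normc_le _) _ => /=; lra.
have {}Hd := Hd _ xyd.
have {}Hd : normc (f (cexp ((s + x) +i* (t + y))) - f (cexp (s +i* t)) - m * (x +i* y))
    <= e * (`|x| + `|y|).
  by apply: le_trans Hd _; rewrite ler_pM2l //; exact: normc_le.
split.
- apply: le_trans Hd; apply: le_trans (Im_le_normc _).
  rewrite le_eqVlt; apply/orP; left; apply/eqP; congr `|_|; rewrite !raddfB /=.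
  by case: (m) => u v /=; ring.
- apply: le_trans Hd; apply: le_trans (Re_le_normc _).
  rewrite le_eqVlt; apply/orP; left; apply/eqP; congr `|_|; rewrite !raddfB /=.
  by case: (m) => u v /=; ring.
Qed.

(** Two circles replace the limits in the mean value argument. On a small one the real part of [u]
    is within [p / 3] of [p], on one near the boundary it is at most [p / 3] in absolute value, yet
    the two integrals over a period agree. *)
Lemma disc_vanishing f :
  (forall z, normc z < 1 -> exists l, has_cderiv f z l) ->
  (forall z, normc z < 1 -> normc z ^+ 2 + normc (f z) ^+ 2 < 1) -> f 0 = 0.
Proof.
move=> df bf; apply/eqP/negPn/negP => f0.
pose p := normc (f 0) ^+ 2.
have p0 : 0 < p.
  rewrite exprn_gt0 // lt_def normc_ge0 andbT; apply: contra f0 => /eqP /eq0_normc ->//.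
(* Multiplying by the conjugate of [f 0] makes the value at 0 real and positive. *)
pose u := fun z => (f 0)^* * f z.
have u0 : u 0 = p%:C.
  rewrite /u /p; case: (f 0) => a b /=.
  apply/eqP; rewrite eq_complex /= sqr_sqrtr ?addr_ge0 ?sqr_ge0 //.
  by apply/andP; split; apply/eqP; ring.
have nconj z : normc z^* = normc z by case: z => a b /=; rewrite sqrrN.
have du z : normc z < 1 -> exists l, has_cderiv u z l.
  move=> /df[l Hl]; exists ((f 0)^* * l) => e e0.
  have n0 := normc_ge0 (f 0); have n1 : 0 < normc (f 0) + 1 by lra.
  have en : 0 < e / (normc (f 0) + 1) by rewrite divr_gt0.
  have [d d0 Hd] := Hl _ en; exists d => // k kd.
  have -> : u (z + k) - u z - (f 0)^* * l * k = (f 0)^* * (f (z + k) - f z - l * k).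
    by rewrite /u; ring.
  rewrite normcM nconj; apply: le_trans (ler_wpM2l n0 (Hd _ kd)) _.
  rewrite mulrA ler_wpM2r ?normc_ge0 // mulrCA -[leRHS]mulr1 ler_wpM2l ?ltW //.
  by rewrite ltr_pdivrMr // mul1r ltrDl.
have cexp_lt1 (s t : R) : s < 0 -> normc (cexp (s +i* t)) < 1.
  by move=> s0; rewrite normc_cexp expR_lt1.
pose P (x y : R) := Im (u (cexp (x +i* y))); pose Q (x y : R) := Re (u (cexp (x +i* y))).
have HC (x y : R) : x < 0 -> closed_at P Q x y.
  by move=> x0; have [l] := du _ (cexp_lt1 x y x0); exact: cexp_comp_closed_at.
have p3 : 0 < p / 3 by rewrite divr_gt0.
have [s1 s10 Hs1] : exists2 s1 : R, s1 < 0 & forall t, `|Q s1 t - p| <= p / 3.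
  have [l Hl] : exists l, has_cderiv u 0 l by apply: du; rewrite normc0 ltr01.
  have [d d0 Hd] := has_cderiv_small Hl p3.
  pose m := Num.min d 1 / 2.
  have m0 : 0 < m by rewrite divr_gt0 // lt_min d0 ltr01.
  have [md m1] : m < d /\ m < 1.
    have m2 : m * 2 = Num.min d 1 by rewrite /m divfK ?pnatr_eq0.
    have [md m1] : m * 2 <= d /\ m * 2 <= 1 by rewrite m2 !ge_min !lexx orbT.
    by split; lra.
  exists (ln m); first by rewrite ln_lt0 // m0.
  move=> t; have := Hd (cexp (ln m +i* t)).
  rewrite add0r normc_cexp /= lnK // u0 => /(_ md) /ltW; apply: le_trans.
  by apply: le_trans (Re_le_normc _); rewrite raddfB.
have [s2 [s12 s20] Hs2] : exists2 s2 : R, s1 < s2 /\ s2 < 0 & forall t, `|Q s2 t| <= p / 3.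
  have p1 : p < 1 by have := bf 0; rewrite normc0 expr0n add0r; apply; rewrite ltr01.
  (* The first bound gives [1 - r ^+ 2 <= p / 9], hence [normc (f z) <= normc (f 0) / 3] on the
     circle of radius [r]. The second puts [r] strictly beyond the first circle. *)
  pose r := Num.max (1 - p / 18) ((1 + expR s1) / 2).
  have es1 : expR s1 < 1 by rewrite expR_lt1.
  have r1 : r < 1 by rewrite gt_max; apply/andP; split; lra.
  have [rp rs] : 1 - p / 18 <= r /\ (1 + expR s1) / 2 <= r by rewrite !le_max !lexx orbT.
  have r0 : 0 < r by have := expR_gt0 s1; lra.
  exists (ln r).
    split; last by rewrite ln_lt0 // r0.
    by rewrite -[s1]expRK ltr_ln ?posrE ?expR_gt0 //; lra.
  move=> t; have ze : normc (cexp (ln r +i* t)) = r by rewrite normc_cexp /= lnK.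
  apply: le_trans (Re_le_normc _) _; rewrite /u normcM nconj.
  set z := cexp _ in ze *; have := bf z; rewrite ze => /(_ r1) bz.
  have fz : normc (f z) <= normc (f 0) / 3.
    rewrite -ler_sqr ?nnegrE ?normc_ge0 ?divr_ge0 ?normc_ge0 // expr_div_n -/p.
    have : (1 - p / 18) ^+ 2 <= r ^+ 2 by rewrite ler_sqr ?nnegrE //; lra.
    by have := sqr_ge0 p; lra.
  by rewrite /p expr2 -mulrA ler_wpM2l ?normc_ge0.
have ppi := pi_gt0 R.
have := @goursat R P Q s1 0 (s2 - s1) (2 * pi).
rewrite subrKC add0r => G.
have {}G : loopint P Q s1 s2 0 (2 * pi) = 0.
  apply: G; [lra|lra|move=> x y xs _; apply: HC; lra].
(* By periodicity the sides [t = 0] and [t = 2 * pi] cancel in the circulation. *)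
have per x : P x (2 * pi) = P x 0.
  by rewrite /P /cexp /= -[2 * pi]add0r mulr_natl cosD2pi sinD2pi.
have B : `|segint (Q s1) 0 (2 * pi) - segint (Q s2) 0 (2 * pi) - p * (2 * pi - 0)|
    <= p * 2 / 3 * (2 * pi - 0).
  apply: segint_sub_bound; first lra.
  - move=> y _; exact: closed_at_continuous2 (HC _ _ s10).
  - move=> y _; exact: closed_at_continuous2 (HC _ _ s20).
  - move=> y _; move: (Hs1 y) (Hs2 y); rewrite !ler_norml; lra.
move: G B; rewrite /loopint (_ : P^~ (2 * pi) = P^~ 0); last exact/funext.
rewrite subrr subr0 => /eqP; rewrite subr_eq0 => /eqP ->.
have pp := mulr_gt0 p0 ppi.
by rewrite subrr sub0r subr0 ler_norml; lra.
Qed.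
End ComplexDerivative.

(** * The tetrablock *)

Section Tetrablock.
Variable R : realType.
Local Notation C := R[i].
Import Normc.

(** * Restriction to complex lines, and columns of contractions *)

Lemma differentiable_line (K : numFieldType) (m n p : nat)
    (h : 'rV[K]_m.+1 -> 'M[K]_(n.+1, p.+1)) (x v : 'rV[K]_m.+1)
    (i : 'I_n.+1) (j : 'I_p.+1) :
  differentiable h x -> exists l : K, forall e : K, 0 < e -> exists2 d : K, 0 < d &
    forall k : K, `|k| < d -> `|h (k *: v + x) i j - h x i j - l * k| <= e * `|k|.
Proof.
move=> /(diff_derivable (v := v)); rewrite /derivable => /cvg_ex[M HM].
have Mij := cvg_comp _ _ HM (@coord_continuous _ _ _ i j M).
exists (M i j) => e e0.
move/cvgrPdist_le: Mij => /(_ _ e0)[d d0 Hd].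
exists d => // k kd; have [->|k0] := eqVneq k 0.
  by rewrite scale0r add0r subrr mulr0 subrr normr0 mulr0.
have := Hd k; rewrite /ball /= sub0r normrN => /(_ kd k0); rewrite !mxE.
set a := h _ i j; set b := h _ i j => H.
have -> : a - b - M i j * k = - (M i j - k^-1 * (a - b)) * k.
  by rewrite mulNr mulrBl mulrAC mulVf // mul1r opprB.
by rewrite normrM normrN ler_wpM2r.
Qed.

Lemma analytic_on_line_cderiv (D : set 'rV[C]_3) (h : 'rV[C]_3 -> 'M[C]_2)
    (v : 'rV[C]_3) (z : C) (i j : 'I_2) :
  analytic_on D h -> D (z *: v) -> exists l, has_cderiv (fun k => h (k *: v) i j) z l.
Proof.
move=> Dh /Dh /differentiable_line => /(_ v i j)[l Hl].
exists l => e e0; have ec0 : 0 < e%:C by rewrite ltcR.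
have [d d0 Hd] := Hl _ ec0.
(* The radius [d] lives in [R[i]], but being positive it is real. *)
have dr : (complex.Re d)%:C = d by rewrite RRe_real // gtr0_real.
exists (complex.Re d); first by rewrite -ltcR dr.
move=> k kd; rewrite [z + k]addrC scalerDl -lecR rmorphM /=; apply: Hd.
by rewrite -dr ltcR.
Qed.

(** This lets [sup] be used as an upper bound. Coordinates of a vector in the unit ball have modulus
    at most 1, so row sums of moduli bound the image. *)
Lemma opnorm_bounded (m n : nat) (A : 'M[C]_(m, n)) :
  has_ubound [set l2norm (A *m v) | v in [set v : 'cV[C]_n | l2norm v <= 1]].
Proof.
exists (Num.sqrt (\sum_(i < m) (\sum_(k < n) normc (A i k)) ^+ 2)) => _ [v /= v1 <-].
apply: ler_wsqrtr; apply: ler_sum => i _.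
have vk k : normc (v k 0) <= 1.
  apply: le_trans v1; rewrite /l2norm -[leLHS]ger0_norm ?normc_ge0 // -sqrtr_sqr.
  by apply: ler_wsqrtr; rewrite (bigD1 k) //= lerDl sumr_ge0 // => l _; exact: sqr_ge0.
rewrite ler_sqr ?nnegrE ?normc_ge0 ?sumr_ge0 // => [|k _]; last exact: normc_ge0.
rewrite mxE; apply: (@le_trans _ _ (\sum_(k < n) normc (A i k * v k 0))).
  elim/big_rec2: _ => [|k a b _ ab]; first by rewrite normc0.
  by apply: le_trans (le_normcD _ _) _; rewrite lerD2l.
apply: ler_sum => k _; rewrite normcM -[leRHS]mulr1.
by rewrite ler_wpM2l ?normc_ge0.
Qed.

(** A column is the image of a unit basis vector. *)
Lemma opnorm_col (m n : nat) (A : 'M[C]_(m, n)) (j : 'I_n) :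
  l2norm (col j A) <= opnorm A.
Proof.
apply: ub_le_sup; first exact: opnorm_bounded.
exists (delta_mx j 0) => /=; last by rewrite colE.
rewrite /l2norm (bigD1 j) //= big1 => [|k kj]; last first.
  by rewrite mxE (negbTE kj) /= expr0n /= addr0 sqrtr0 expr0n.
by rewrite mxE !eqxx /= expr1n expr0n /= !addr0 sqrtr1 expr1n sqrtr1.
Qed.

Lemma RI22_col (A : 'M[C]_2) (j : 'I_2) : RI22 A ->
  normc (A 0 j) ^+ 2 + normc (A 1 j) ^+ 2 < 1.
Proof.
move/(le_lt_trans (opnorm_col A j)).
rewrite /l2norm !big_ord_recl big_ord0 addr0 !mxE -[ltRHS]sqrtr1 ltr_sqrt //.
by congr (_ + normc (A _ _) ^+ 2 < 1); apply/val_inj.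
Qed.

Lemma det_mx22 (K : comPzRingType) (A : 'M[K]_2) : \det A = A 0 0 * A 1 1 - A 0 1 * A 1 0.
Proof.
rewrite (expand_det_row _ 0) !big_ord_recl big_ord0 addr0 /cofactor !det_mx11 !mxE /=.
rewrite /bump /= !addn0 expr0 mul1r expr1 mulN1r mulrN.
by congr (A _ _ * A _ _ - A _ _ * A _ _); apply/val_inj.
Qed.

(** On an axis the defining expression is [1 - z * c] with [c] equal to [a], [b] or [- (a * b)], so
    [c] has modulus at most 1. *)
Lemma tetrablock_axis (k : 'I_3) (z : C) : normc z < 1 -> tetrablock (z *: delta_mx 0 k).
Proof.
move=> z1 a b a1 b1.
have nlt (c : C) : `|c| <= 1 -> 1 - z * c != 0.
  move=> c1; apply/negP; rewrite subr_eq0 => /eqP E.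
  have z1' : `|z| < 1 by rewrite -[1]/(1%:C) ltcR.
  have : `|z * c| < 1 by rewrite normrM (le_lt_trans _ z1') // ler_piMr.
  by rewrite -E normr1 ltxx.
have ab1 : `|- (a * b)| <= 1 by rewrite normrN normrM mulr_ile1.
rewrite !mxE /=.
case: k => [[|[|[|//]]] k3]; rewrite /= ?mulr1 ?mulr0 ?mul0r ?subr0 ?addr0.
- exact: nlt.
- exact: nlt.
- by have := nlt _ ab1; rewrite mulrN opprK mulrA.
Qed.

Lemma entry_vanishing (h : 'rV[C]_3 -> 'M[C]_2) (v : 'I_3) (i j : 'I_2) :
  analytic_on (@tetrablock R) h ->
  (forall z : C, normc z < 1 -> normc z ^+ 2 + normc (h (z *: delta_mx 0 v) i j) ^+ 2 < 1) ->
  h 0 i j = 0.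
Proof.
move=> ah bh; rewrite -(scale0r (delta_mx 0 v)).
apply: (disc_vanishing (f := fun z => h (z *: delta_mx 0 v) i j)) => // z z1.
by apply: analytic_on_line_cderiv ah _; exact: tetrablock_axis.
Qed.

End Tetrablock.

(** * The contradiction along the third axis *)

Theorem theorem8p2 (R : realType) :
  ~ exists h : 'rV[R[i]]_3 -> 'M[R[i]]_2,
      [/\ analytic_on (@tetrablock R) h,
          forall x, tetrablock x -> RI22 (h x)
        & forall x, tetrablock x -> pi_map (h x) = x].
Proof.
case=> h [ah bh ph].
have pih (x : 'rV[R[i]]_3) : tetrablock x -> [/\ h x 0 0 = x 0 0, h x 1 1 = x 0 1 &
    h x 0 1 * h x 1 0 = x 0 0 * x 0 1 - x 0 2].
  move=> /ph E; have p0 : h x 0 0 = x 0 0 by rewrite -[in RHS]E mxE.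
  have p1 : h x 1 1 = x 0 1 by rewrite -[in RHS]E mxE.
  have : \det (h x) = x 0 2 by rewrite -[in RHS]E mxE.
  by rewrite det_mx22 p0 p1 => <-; split=> //; rewrite opprB addrC subrK.
have c0 : h 0 1 0 = 0.
  apply: (entry_vanishing (v := 0)) => // z z1; have tz := tetrablock_axis 0 z1.
  by have := RI22_col 0 (bh _ tz); have [-> _ _] := pih _ tz; rewrite !mxE mulr1.
have b0 : h 0 0 1 = 0.
  apply: (entry_vanishing (v := 1)) => // z z1; have tz := tetrablock_axis 1 z1.
  by have := RI22_col 1 (bh _ tz); have [_ -> _] := pih _ tz; rewrite !mxE mulr1 addrC.
have t0 : tetrablock ((0 : R[i]) *: delta_mx 0 (2 : 'I_3)).
  by apply: tetrablock_axis; rewrite Normc.normc0.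
have [l Hl] := analytic_on_line_cderiv 0 1 ah t0.
have [m Hm] := analytic_on_line_cderiv 1 0 ah t0.
have [d1 d10 H1] := has_cderiv_lip Hl; have l0 := normc_ge0 l.
(* At [(0, 0, k)] the entry [h x 0 1] has modulus at most [(normc l + 1) * k]. Making [h x 1 0]
   smaller than the inverse of that constant forces their product, of modulus [k], below [k]. *)
have e0 : 0 < (Normc.normc l + 1)^-1 by rewrite invr_gt0; lra.
have [d2 d20 H2] := has_cderiv_small Hm e0.
pose k : R := Num.min 1 (Num.min d1 d2) / 2.
have k2 : k * 2 = Num.min 1 (Num.min d1 d2) by rewrite /k divfK ?pnatr_eq0.
have k0 : 0 < k by rewrite divr_gt0 // !lt_min ltr01 d10 d20.
have [[k1 kd1] kd2] : (k * 2 <= 1 /\ k * 2 <= d1) /\ k * 2 <= d2.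
  by rewrite k2 !ge_min !lexx !orbT.
have nk : Normc.normc k%:C = k by rewrite normc_complex_real gtr0_norm.
have := H1 k%:C; have := H2 k%:C; rewrite nk !add0r scale0r b0 c0 !subr0.
set x := k%:C *: _ => /(_ _) h2 /(_ _) h1.
have tx : tetrablock x by apply: tetrablock_axis; rewrite nk; lra.
have [_ _] := pih _ tx; rewrite !mxE /= mulr1 !mulr0 sub0r => /(congr1 (@Normc.normc R)).
rewrite Normc.normcM normcN nk => bc.
have {}h1 : Normc.normc (h x 0 1) <= (Normc.normc l + 1) * k by apply: h1; lra.
have {}h2 : Normc.normc (h x 1 0) < (Normc.normc l + 1)^-1 by apply: h2; lra.
have l1 : 0 < Normc.normc l + 1 by lra.
suff : k < k by rewrite ltxx.
rewrite -[X in X < _]bc.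
apply: le_lt_trans (ler_wpM2r (normc_ge0 _) h1) _.
rewrite mulrAC -[ltRHS]mul1r ltr_pM2r // mulrC -ltr_pdivlMr // div1r //.
Qed.
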